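(* Let $n\geq 1$ and $p\in[0,1]$. For any non-decreasing boolean function $f:\{0,1\}^n\to\{0,1\}$ with $P(f=1)>0$, we have $$P(f=1)\,\leq\,2\exp\Big(-\frac12\sum_{1\leq i\leq n}\Big((1-p)\,P\big(i\in\mathcal P(f)\,\big|\,f=1\big)\Big)^2\Big)\,.$$
   Context: Let $\Omega=\{0,1\}^n$, with elements $\omega=(\omega(1),\dots,\omega(n))$. The probability $P$ on $\Omega$ is the Bernoulli product measure of parameter $p$: $P(\omega)=\prod_{1\leq i\leq n}p^{\omega(i)}(1-p)^{1-\omega(i)}$ (with $0^0=1$). For $\omega\in\Omega$ and $i\in\{1,\dots,n\}$, $\omega^i$ (respectively $\omega_i$) denotes the configuration equal to $\omega$ except that its $i$-th component is set to $1$ (respectively to $0$). A boolean function is a function $f:\Omega\to\{0,1\}$; it is non-decreasing if $f(\omega_i)\leq f(\omega^i)$ for all $\omega\in\Omega$ and all $i\in\{1,\dots,n\}$. The coordinate $i$ is pivotal for $f$ in $\omega$ if $f(\omega^i)\neq f(\omega_i)$. The pivotal set $\mathcal P(f,\omega)\subset\{1,\dots,n\}$ is the set of the coordinates that are pivotal for $f$ in $\omega$; $\mathcal P(f)$ denotes the random set $\omega\mapsto\mathcal P(f,\omega)$. $P(\,\cdot\,|\,f=1)$ is the conditional probability given the event $\{\omega\in\Omega: f(\omega)=1\}$. *)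

(* Defs.v *)
From HB Require Import structures.
From mathcomp Require Import all_boot all_order all_algebra.
From mathcomp Require Import reals.

Set Implicit Arguments.
Unset Strict Implicit.
Unset Printing Implicit Defensive.

Import Order.TTheory GRing.Theory Num.Theory.

Local Open Scope ring_scope.

(* The value 1 of a component is [true], the value 0 is [false]; coordinates
   are numbered from 0 to n - 1. *)
Definition config (n : nat) := {ffun 'I_n -> bool}.

Definition set_coord (n : nat) (w : config n) (i : 'I_n) (b : bool) : config n :=
  [ffun j => if j == i then b else w j].

Definition boolean_function (n : nat) := config n -> bool.

(* The comparison is that of the values in {0, 1}, seen in [nat]. *)
Definition nondecreasing_bf (n : nat) (f : boolean_function n) : Prop :=
  forall (w : config n) (i : 'I_n),
    (f (set_coord w i false) <= f (set_coord w i true))%N.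

(* [x ^+ 0 = 1] for every [x], including [x = 0]. *)
Definition bernoulli_weight (R : realType) (n : nat) (p : R) (w : config n) : R :=
  \prod_(i < n) (p ^+ (w i : nat) * (1 - p) ^+ (1 - w i)%N).

Definition bernoulli_prob (R : realType) (n : nat) (p : R)
    (A : {set config n}) : R :=
  \sum_(w in A) bernoulli_weight p w.

Definition bernoulli_cond_prob (R : realType) (n : nat) (p : R)
    (A B : {set config n}) : R :=
  bernoulli_prob p (A :&: B) / bernoulli_prob p B.

Definition pivotal (n : nat) (f : boolean_function n) (w : config n)
    (i : 'I_n) : bool :=
  f (set_coord w i true) != f (set_coord w i false).

Definition pivotal_set (n : nat) (f : boolean_function n) (w : config n) :
    {set 'I_n} :=
  [set i | pivotal f w i].

Definition event_one (n : nat) (f : boolean_function n) : {set config n} :=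
  [set w | f w].

(* Main.v *)
(* Let x_i = (1 - p) P(i pivotal | f = 1). Resampling the i-th component shows,
   by monotonicity, that x_i = E[w(i) - p | f = 1]; hence the variable
   Y = sum_i x_i (w(i) - p) has conditional mean S = sum_i x_i^2 given f = 1.
   By Jensen's inequality and independence,
   P(f = 1) exp S <= E[exp Y; f = 1] <= prod_i E[exp (x_i (w(i) - p))],
   and each factor is at most exp (x_i^2 / 2). This yields the bound even
   without the prefactor 2. *)
Require Import Defs.
From HB Require Import structures.
From mathcomp Require Import all_boot all_order all_algebra.
From mathcomp Require Import reals sequences.
From mathcomp Require Import exp ring lra.

Set Implicit Arguments.
Unset Strict Implicit.
Unset Printing Implicit Defensive.

Import Order.TTheory GRing.Theory Num.Theory.

Local Open Scope ring_scope.

Lemma expR_le_quadratic (R : realType) (u : R) :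
  u <= 1 -> expR u <= 1 + u + 2 * u ^+ 2.
Proof.
move=> u1.
(* [exp u = exp (- u / 2) ^ -2], and [exp (- u / 2) >= 1 - u / 2 > 0]. *)
have h : 1 - u / 2 <= expR (- (u / 2)).
  by have := expR_ge1Dx (- (u / 2)).
have e : expR u * expR (- (u / 2)) ^+ 2 = 1.
  by rewrite expr2 -!expRD (_ : u + _ = 0) ?expR0 //; field.
have a0 : 0 < 1 - u / 2 by lra.
have h2 : (1 - u / 2) ^+ 2 <= expR (- (u / 2)) ^+ 2.
  by rewrite ler_sqr ?nnegrE // ?expR_ge0 // ltW.
have a2 : 0 < (1 - u / 2) ^+ 2 by rewrite exprn_gt0.
rewrite -(ler_pM2r a2); apply: (@le_trans _ _ 1).
  by rewrite -[leRHS]e ler_wpM2l // expR_ge0.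
(* The linear terms cancel, and both factors [1 - u] and [5 / 2 - u] are nonnegative because
   [u <= 1]. *)
have -> : (1 + u + 2 * u ^+ 2) * (1 - u / 2) ^+ 2 =
    1 + u ^+ 2 * ((1 - u) * (5 / 2 - u) / 2) by field.
rewrite lerDl mulr_ge0 ?sqr_ge0 // divr_ge0 ?mulr_ge0 //; lra.
Qed.

(** Averaging the quadratic bound kills the linear term and leaves [1 + 2 * s ^+ 2 * (p * (1 - p))].
    As [p * (1 - p) <= 1 / 4], this is at most [1 + s ^+ 2 / 2]. The form [0 - p] matches [b%:R - p]
    at [b = false]. *)
Lemma centered_bernoulli_mgf_le (R : realType) (p s : R) :
  0 <= p <= 1 -> 0 <= s <= 1 ->
  p * expR (s * (1 - p)) + (1 - p) * expR (s * (0 - p)) <= expR (s ^+ 2 / 2).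
Proof.
move=> /andP[p0 p1] /andP[s0 s1].
have q0 : 0 <= 1 - p by lra.
have u1 : s * (1 - p) <= 1 by rewrite mulr_ile1 //; lra.
have u0 : s * (0 - p) <= 1.
  by apply: (@le_trans _ _ 0) => //; rewrite mulr_ge0_le0 //; lra.
have := lerD (ler_wpM2l p0 (expR_le_quadratic u1))
             (ler_wpM2l q0 (expR_le_quadratic u0)).
move=> /le_trans; apply; apply: le_trans (expR_ge1Dx _).
rewrite -subr_ge0.
have -> : 1 + s ^+ 2 / 2 -
    (p * (1 + s * (1 - p) + 2 * (s * (1 - p)) ^+ 2) +
     (1 - p) * (1 + s * (0 - p) + 2 * (s * (0 - p)) ^+ 2)) =
    (s * (1 - 2 * p)) ^+ 2 / 2 by field.
by rewrite divr_ge0 ?sqr_ge0.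
Qed.

Definition flip_coord (n : nat) (i : 'I_n) (w : config n) : config n :=
  set_coord w i (~~ w i).

Lemma flip_coordK (n : nat) (i : 'I_n) : involutive (@flip_coord n i).
Proof.
move=> w; apply/ffunP=> j; rewrite !ffunE eqxx.
by case: eqP => // ->; rewrite negbK.
Qed.

Lemma set_coord_id (n : nat) (w : config n) (i : 'I_n) :
  set_coord w i (w i) = w.
Proof. by apply/ffunP=> j; rewrite ffunE; case: eqP => [->|]. Qed.

Section BernoulliMeasure.
Variables (R : realType) (n : nat) (p : R).

Lemma bernoulli_weight_ge0 (w : config n) :
  0 <= p <= 1 -> 0 <= bernoulli_weight p w.
Proof.
move=> /andP[p0 p1]; apply: prodr_ge0 => i _.
by rewrite mulr_ge0 ?exprn_ge0 // subr_ge0.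
Qed.

(** Independence of the coordinates: expanding the product of two-term sums gives one term per
    configuration. *)
Lemma bernoulli_expect_prod (g : 'I_n -> bool -> R) :
  \sum_(w : config n) bernoulli_weight p w * \prod_i g i (w i) =
  \prod_i (p * g i true + (1 - p) * g i false).
Proof.
transitivity (\prod_(i < n) \sum_(b : bool)
    (p ^+ (b : nat) * (1 - p) ^+ (1 - b)%N * g i b)).
  rewrite bigA_distr_bigA /=; apply: eq_bigr => w _.
  by rewrite -big_split.
by apply: eq_bigr => i _; rewrite big_bool /= !expr0 !expr1 mulr1 mul1r.
Qed.

(** The hypothesis says that the mean of [F] given all coordinates other than [i] vanishes. *)
Lemma bernoulli_expect_eq0 (i : 'I_n) (F : config n -> R) :
  (forall w, p * F (set_coord w i true) + (1 - p) * F (set_coord w i false) = 0)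
  -> \sum_w bernoulli_weight p w * F w = 0.
Proof.
move=> F0.
pose E := \sum_w bernoulli_weight p w * F w.
(* Pair each configuration with its flip at [i]. *)
have EE : E + E = 0.
  rewrite {2}/E (reindex_inj (inv_inj (@flip_coordK n i))) /= -big_split /=.
  apply: big1 => w _.
  (* [r] is the weight of the other coordinates, common to [w] and its flip. *)
  pose r := \prod_(j < n | j != i) (p ^+ w j * (1 - p) ^+ (1 - w j)).
  have weightE (v : config n) : (forall j, j != i -> v j = w j) ->
      bernoulli_weight p v = p ^+ v i * (1 - p) ^+ (1 - v i) * r.
    move=> vw; rewrite /bernoulli_weight (bigD1 i) //=.
    by congr (_ * _); apply: eq_bigr => j /vw ->.
  rewrite !weightE // => [|j /negbTE ji]; last by rewrite ffunE ji.
  transitivity (r * (p * F (set_coord w i true) +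
                     (1 - p) * F (set_coord w i false))); last first.
    by rewrite F0 mulr0.
  rewrite /flip_coord ffunE eqxx -[in F w](set_coord_id w i).
  by case: (w i) => /=; rewrite !expr0 !expr1; ring.
by rewrite -/E; lra.
Qed.

Lemma bernoulli_probE (A : {set config n}) :
  bernoulli_prob p A = \sum_w bernoulli_weight p w * (w \in A)%:R.
Proof.
rewrite /bernoulli_prob big_mkcond; apply: eq_bigr => w _.
by case: (w \in A); rewrite ?mulr1 ?mulr0.
Qed.

(** Fix the other coordinates. If [f] is constant in coordinate [i], that coordinate is not pivotal
    and the bias averages to 0. Otherwise monotonicity forces [f = 1] exactly when [w i = 1], where
    the bias is [1 - p]. *)
Lemma pivotal_prob_eq_bias (f : boolean_function n) (i : 'I_n) :
  nondecreasing_bf f ->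
  (1 - p) * bernoulli_prob p ([set w | i \in pivotal_set f w] :&: event_one f) =
  \sum_(w in event_one f) bernoulli_weight p w * ((w i)%:R - p).
Proof.
move=> hf; apply/esym/eqP; rewrite -subr_eq0 bernoulli_probE mulr_sumr.
rewrite [X in X - _]big_mkcond -sumrB /=; apply/eqP.
rewrite -[RHS](@bernoulli_expect_eq0 i (fun w =>
  (f w)%:R * ((w i)%:R - p) - (1 - p) * (pivotal f w i && f w)%:R)).
  apply: eq_bigr => w _; rewrite !inE.
  by case: (f w); rewrite ?andbT ?andbF /=; ring.
move=> w; rewrite /pivotal.
have ss b c : set_coord (set_coord w i b) i c = set_coord w i c.
  by apply/ffunP=> j; rewrite !ffunE; case: eqP.
rewrite !ss !ffunE eqxx; move: (hf w i).
by case: (f (set_coord w i true)); case: (f (set_coord w i false)) => //= _; ring.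
Qed.

Lemma bernoulli_cond_prob_itv (A B : {set config n}) :
  0 <= p <= 1 -> 0 < bernoulli_prob p B ->
  0 <= bernoulli_cond_prob p A B <= 1.
Proof.
move=> hp B0; have W0 w := bernoulli_weight_ge0 w hp.
rewrite /bernoulli_cond_prob divr_ge0 ?sumr_ge0 //= ler_pdivrMr // mul1r.
rewrite !bernoulli_probE; apply: ler_sum => w _; rewrite ler_wpM2l // inE.
by case: (w \in A); case: (w \in B); rewrite /= ?ler01 ?lexx.
Qed.

(** The tangent to [expR] at [m] lies below it, and its weighted sum over [A] is exactly the
    left-hand side. Leaving both sides unnormalised also covers events of probability 0. *)
Lemma jensen_expR (A : {set config n}) (Y : config n -> R) (m : R) :
  0 <= p <= 1 ->
  \sum_(w in A) bernoulli_weight p w * Y w = bernoulli_prob p A * m ->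
  bernoulli_prob p A * expR m <=
  \sum_(w in A) bernoulli_weight p w * expR (Y w).
Proof.
move=> hp hY.
have -> : bernoulli_prob p A * expR m =
    \sum_(w in A) bernoulli_weight p w * (expR m * (1 + (Y w - m))).
  transitivity (expR m * (bernoulli_prob p A * (1 - m) +
      \sum_(w in A) bernoulli_weight p w * Y w)); first by rewrite hY; ring.
  rewrite mulr_suml -big_split mulr_sumr /=.
  by apply: eq_bigr => w _; ring.
apply: ler_sum => w _; apply: ler_wpM2l; first exact: bernoulli_weight_ge0.
rewrite (_ : expR (Y w) = expR m * expR (Y w - m)); last first.
  by rewrite -expRD addrC subrK.
by rewrite ler_wpM2l ?expR_ge0 // expR_ge1Dx.
Qed.

End BernoulliMeasure.

Theorem corollary10p2 (R : realType) (n : nat) (hn : (1 <= n)%N) (p : R)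
    (hp0 : 0 <= p) (hp1 : p <= 1) (f : boolean_function n)
    (hf : nondecreasing_bf f) (hpos : 0 < bernoulli_prob p (event_one f)) :
  bernoulli_prob p (event_one f) <=
  2 * expR (- (1 / 2) *
      \sum_(i < n)
        ((1 - p) *
         bernoulli_cond_prob p [set w | i \in pivotal_set f w] (event_one f)) ^+ 2).
Proof.
have hp : 0 <= p <= 1 by rewrite hp0.
set q := bernoulli_prob p (event_one f).
pose x i := (1 - p) *
  bernoulli_cond_prob p [set w | i \in pivotal_set f w] (event_one f).
set S := \sum_(i < n) x i ^+ 2.
have xbias i :
    \sum_(w in event_one f) bernoulli_weight p w * ((w i)%:R - p) = q * x i.
  rewrite -pivotal_prob_eq_bias // /x /bernoulli_cond_prob -/q.
  by field; rewrite gt_eqF.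
(* This range makes [centered_bernoulli_mgf_le] applicable with [s = x i]. *)
have x01 i : 0 <= x i <= 1.
  have /andP[c0 c1] := bernoulli_cond_prob_itv
    [set w | i \in pivotal_set f w] hp hpos.
  by rewrite /x; apply/andP; split; [apply: mulr_ge0|apply: mulr_ile1]; lra.
pose Y (w : config n) := \sum_i x i * ((w i)%:R - p).
have meanY : \sum_(w in event_one f) bernoulli_weight p w * Y w = q * S.
  under eq_bigr do rewrite mulr_sumr.
  rewrite exchange_big /S mulr_sumr; apply: eq_bigr => i _ /=.
  rewrite expr2 mulrCA -xbias mulr_sumr; apply: eq_bigr => w _.
  by rewrite mulrCA.
have expY : \sum_(w in event_one f) bernoulli_weight p w * expR (Y w) <=
    expR (S / 2).
  (* Adding the nonnegative terms outside the event gives a full expectation, which independence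
     factorises. *)
  apply: (@le_trans _ _ (\sum_w bernoulli_weight p w * expR (Y w))).
    rewrite big_mkcond; apply: ler_sum => w _; case: ifP => // _.
    by rewrite mulr_ge0 ?expR_ge0 ?bernoulli_weight_ge0.
  under eq_bigr do rewrite expR_sum.
  rewrite (bernoulli_expect_prod p (fun i b => expR (x i * (b%:R - p)))).
  rewrite /S mulr_suml expR_sum; apply: ler_prod => i _.
  rewrite centered_bernoulli_mgf_le // andbT.
  by rewrite addr_ge0 // mulr_ge0 ?expR_ge0 // subr_ge0.
have qS : q <= expR (- (1 / 2) * S).
  (* After this multiplication the right-hand side is [expR (S / 2)], the bound of [expY]. *)
  rewrite -(ler_pM2r (expR_gt0 S)).
  apply: le_trans (jensen_expR hp meanY) _; apply: le_trans expY _.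
  by rewrite -expRD ler_expR; lra.
by apply: le_trans qS _; rewrite ler_peMl ?expR_ge0 // ler1n.
Qed.
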